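(* Let $\gamma\in(0,2)$, $H=\gamma/2$ and $N\ge1$. Let $\mathcal{T}_N^+$ be the complex span of $e^{inx}$, $1\le n\le N$, on $\mathbb{T}=\mathbb{R}/(2\pi\mathbb{Z})$, and let $\kappa(\gamma,N)$ be the Bakry–Émery curvature of $L_\gamma=-(-\Delta)^{\gamma/2}$ on $\mathcal{T}_N^+$, i.e. the largest real $\kappa$ such that $\Gamma_2(f,f)(x)\ge\kappa\,\Gamma(f,f)(x)$ for all $f\in\mathcal{T}_N^+$ and all $x\in\mathbb{T}$. Then $$\kappa(\gamma,N)=\lambda_{\min}\bigl(R_H^{\circ2},R_H\bigr),$$ where $R_H$ is the $N\times N$ matrix with entries $R_H(n,m)=\tfrac12\bigl(n^{2H}+m^{2H}-|n-m|^{2H}\bigr)$, $1\le n,m\le N$, $R_H^{\circ2}$ is its entrywise square, and $\lambda_{\min}(A,B)$ is the smallest generalized eigenvalue, i.e. the smallest $\lambda$ with $\det(A-\lambda B)=0$.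
   Context: For $\gamma\in(0,2)$, $L_\gamma=-(-\Delta)^{\gamma/2}$ acts on $\mathbb{T}$ by $L_\gamma(e^{inx})=-|n|^\gamma e^{inx}$, $n\in\mathbb{Z}$. Its sesquilinear carré du champ $\Gamma$ (linear in the first argument, conjugate-linear in the second) is $$\Gamma(f,g)(x)=\tfrac12\int_{\mathbb{R}\setminus\{0\}}[f(x+z)-f(x)]\,\overline{[g(x+z)-g(x)]}\,\nu_\gamma(dz),$$ with $\nu_\gamma(dz)=c_\gamma|z|^{-1-\gamma}dz$ and $c_\gamma>0$ normalized by $|\xi|^\gamma=\int(1-\cos\xi z)\,\nu_\gamma(dz)$; on Fourier modes $\Gamma(e^{in\cdot},e^{im\cdot})(x)=e^{i(n-m)x}\,\tfrac12(|n|^\gamma+|m|^\gamma-|n-m|^\gamma)$. The iterated carré du champ is $\Gamma_2(f,f)=\tfrac12\bigl[L_\gamma(\Gamma(f,f))-\Gamma(f,L_\gamma f)-\Gamma(L_\gamma f,f)\bigr]$. *)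

(* Defs.v *)
From HB Require Import structures.
From mathcomp Require Import all_boot all_order all_algebra.
From mathcomp Require Import complex.
From mathcomp Require Import all_classical all_reals all_analysis.
Import Order.TTheory GRing.Theory Num.Theory.
Import numFieldNormedType.Exports.

Set Implicit Arguments.
Unset Strict Implicit.
Unset Printing Implicit Defensive.

Local Open Scope classical_set_scope.
Local Open Scope complex_scope.
Local Open Scope ring_scope.

(* Functions on the torus R/(2 pi Z) are represented by 2pi-periodic functions
   R -> R[i]; x ranges over all of R. *)

Definition Cintegral {R : realType} (D : set R) (F : R -> R[i]) : R[i] :=
  (\int[lebesgue_measure]_(x in D) complex.Re (F x))
    +i* (\int[lebesgue_measure]_(x in D) complex.Im (F x)).

Definition fourier_mode {R : realType} (n : int) (x : R) : R[i] :=
  cos (n%:~R * x) +i* sin (n%:~R * x).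

Definition fourier_coef {R : realType} (f : R -> R[i]) (n : int) : R[i] :=
  ((2 * pi)^-1)%:C *
    Cintegral `[0, 2 * pi] (fun x => f x * fourier_mode (- n) x).

(* L_gamma = -(-Delta)^(gamma/2) as a Fourier multiplier.  The sum over int is
   the library's finite-support sum: it is the intended operator on
   trigonometric polynomials, the only functions L_gamma is applied to. *)
Definition frac_laplacian {R : realType} (gamma : R) (f : R -> R[i])
    (x : R) : R[i] :=
  \sum_(n \in [set: int])
    ((- (`|n|%N%:R `^ gamma))%:C * fourier_coef f n * fourier_mode n x).

(* The set has exactly one element for 0 < gamma < 2; the default value 0 is
   irrelevant. *)
Definition levy_const {R : realType} (gamma : R) : R :=
  xget 0 [set c : R | 0 < c /\
    forall xi : R,
      (`|xi| `^ gamma)%:E =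
      (\int[lebesgue_measure]_(z in ~` [set 0%R : R])
         ((1 - cos (xi * z)) * (c * `|z| `^ (- 1 - gamma)))%R%:E)%E].

(* Density of nu_gamma with respect to Lebesgue measure on R \ {0}. *)
Definition levy_density {R : realType} (gamma z : R) : R :=
  levy_const gamma * `|z| `^ (- 1 - gamma).

Definition carre_du_champ {R : realType} (gamma : R) (f g : R -> R[i])
    (x : R) : R[i] :=
  2^-1 * Cintegral (~` [set 0])
    (fun z => (f (x + z) - f x) * (g (x + z) - g x)^*
              * (levy_density gamma z)%:C).

Definition iterated_carre_du_champ {R : realType} (gamma : R) (f : R -> R[i])
    (x : R) : R[i] :=
  2^-1 * (frac_laplacian gamma (carre_du_champ gamma f f) x
          - carre_du_champ gamma f (frac_laplacian gamma f) x
          - carre_du_champ gamma (frac_laplacian gamma f) f x).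

Definition pos_trig_polys {R : realType} (N : nat) : set (R -> R[i]) :=
  [set f | exists a : 'I_N -> R[i],
     f = fun x => \sum_(i < N) a i * fourier_mode i.+1%:Z x].

(* The inequality is in the partial order of R[i]: z <= w iff w - z is a
   nonnegative real. *)
Definition curvature_bound {R : realType} (gamma : R) (N : nat) : set R :=
  [set kappa | forall f, pos_trig_polys N f -> forall x : R,
     kappa%:C * carre_du_champ gamma f f x
       <= iterated_carre_du_champ gamma f x].

Definition is_greatest {R : realType} (S : set R) (x : R) : Prop :=
  S x /\ ubound S x.

Definition is_least {R : realType} (S : set R) (x : R) : Prop :=
  S x /\ lbound S x.

Definition is_bakry_emery_curvature {R : realType} (gamma : R) (N : nat)
    (kappa : R) : Prop :=
  is_greatest (curvature_bound gamma N) kappa.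

Definition is_min_gen_eigenvalue {R : realType} (N : nat) (A B : 'M[R]_N)
    (lambda : R) : Prop :=
  is_least [set l | \det (A - l *: B) = 0] lambda.

(* Index i : 'I_N stands for the integer i + 1. *)
Definition fbm_mx {R : realType} (H : R) (N : nat) : 'M[R]_N :=
  \matrix_(i, j) (2^-1 * (i.+1%:R `^ (2 * H) + j.+1%:R `^ (2 * H)
                          - `|i.+1%:R - j.+1%:R| `^ (2 * H))).

Definition hadamard_sq {R : realType} (N : nat) (A : 'M[R]_N) : 'M[R]_N :=
  map_mx (fun a => a ^+ 2) A.

(* Main.v *)
Require Import Defs.
From mathcomp Require Import all_boot all_order all_algebra.
From mathcomp Require Import complex.
From mathcomp Require Import all_classical all_reals all_analysis.
From mathcomp Require Import measurable_realfun ring lra.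
Import Order.TTheory GRing.Theory Num.Theory.
Import numFieldNormedType.Exports.
Set Implicit Arguments.
Unset Strict Implicit.
Local Open Scope ring_scope.

(** The proof computes both quadratic forms on the Fourier side and then
    minimises a Rayleigh quotient.

    [Gamma] and [Gamma_2] are sesquilinear, so for trigonometric polynomials only
    pairs of modes matter.  Expanding [(e_n(z) - 1) * conj (e_m(z) - 1)] gives a
    real part made of three terms [1 - cos], each integrated by the
    Lévy-Khintchine normalisation of the density, and an odd imaginary part,
    which integrates to 0.  Hence [Gamma(e_n, e_m)] is [e_(n-m)] times
    [mode_cov n m = (|n|^gamma + |m|^gamma - |n-m|^gamma) / 2]
    ([carre_du_champ_trig]).  The Laplacian multiplies [e_n] by [-|n|^gamma], so
    the three terms of [Gamma_2(e_n, e_m)] reassemble to [e_(n-m)] times the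
    square of [mode_cov n m] ([iterated_carre_du_champ_trig]): this is where the
    entrywise square of the covariance matrix comes from.

    At a point [x], the phases [e_n(x)] can be absorbed in the coefficients of
    [f], which range over all complex vectors.  A real symmetric matrix has on
    [u + i v] the value it has on [u] plus the value it has on [v], so the
    curvature inequality is the inequality [l * B <= A] between the real
    quadratic forms of [B = R_H] and of its entrywise square [A]
    ([curvature_bound_bform]).

    The matrix [R_H] is positive definite because its quadratic form is an
    energy: if it vanishes, then the increments of [f] from 0 vanish almost
    everywhere, so [f] is constant almost everywhere and its Fourier
    coefficients at positive frequencies are 0 ([fbm_mx_posdef]).  For
    a symmetric pencil with positive definite [B], the minimum over the unit
    sphere of [A(u,u) / B(u,u)] is at once the largest [l] with [l * B <= A] and
    the least root of [det (A - l * B)] ([pencil_min_eigenvalue]).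

    That the normalising constant exists is part of the work: the integral of
    [(1 - cos z) * |z|^(-1-gamma)] is positive and finite for
    [0 < gamma < 2], and the substitution [z -> |xi| z] turns it into a multiple
    of [|xi|^gamma] ([levy_const_spec]). *)

(** * Symmetric pencils of quadratic forms *)

Section SymmetricPencils.
Local Open Scope classical_set_scope.
Local Open Scope ring_scope.
Context {R : realType} {N : nat}.
Implicit Types (A B : 'M[R]_N) (u v : 'rV[R]_N).

Definition bform A u v : R := (u *m A *m v^T) 0 0.

Lemma bformE A u v : bform A u v = \sum_i \sum_j u 0 i * v 0 j * A i j.
Proof.
rewrite /bform mxE exchange_big /=; apply: eq_bigr => j _.
rewrite !mxE mulr_suml; apply: eq_bigr => i _; ring.
Qed.

Lemma bformDl A u u' v : bform A (u + u') v = bform A u v + bform A u' v.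
Proof. by rewrite /bform !mulmxDl mxE. Qed.

Lemma bformDr A u v v' : bform A u (v + v') = bform A u v + bform A u v'.
Proof. by rewrite /bform linearD /= mulmxDr mxE. Qed.

Lemma bformZl A a u v : bform A (a *: u) v = a * bform A u v.
Proof. by rewrite /bform -!scalemxAl mxE. Qed.

Lemma bformZr A a u v : bform A u (a *: v) = a * bform A u v.
Proof. by rewrite /bform linearZ /= -scalemxAr mxE. Qed.

Lemma bform_pencil A B l u v :
  bform (A - l *: B) u v = bform A u v - l * bform B u v.
Proof.
by rewrite /bform mulmxBr mulmxBl -scalemxAr -scalemxAl !mxE.
Qed.

Lemma bform_sym A u v : A^T = A -> bform A u v = bform A v u.
Proof.
move=> As; rewrite !bformE exchange_big; apply: eq_bigr => i _.
by apply: eq_bigr => j _; rewrite [u 0 j * _]mulrC -[in LHS]As mxE.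
Qed.

Lemma bform0 A : bform A 0 0 = 0.
Proof. by rewrite /bform mul0mx mul0mx mxE. Qed.

Lemma bform_continuous A : continuous (fun u => bform A u u).
Proof.
under eq_fun do rewrite bformE.
apply: continuous_big => [|i _]; first exact: add_continuous.
apply: continuous_big => [|j _ u]; first exact: add_continuous.
apply: (@continuousM R 'rV[R]_N (fun x => x 0 i * x 0 j) (fun=> A i j));
  last exact: cst_continuous.
apply: (@continuousM R 'rV[R]_N (fun x => x 0 i) (fun x => x 0 j));
  exact: coord_continuous.
Qed.

(** Cauchy-Schwarz for a semidefinite form: an isotropic vector is orthogonal
    to every vector. *)
Lemma psd_isotropic_ker A u : A^T = A -> (forall v, 0 <= bform A v v) ->
  bform A u u = 0 -> u *m A = 0.
Proof.
move=> As Apos Au0.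
have orth v : bform A u v = 0.
  have Av := Apos v.
  (* The form takes the value - A(u,v)^2 * (A(v,v) + 2) at this vector; the
     coefficient A(v,v) + 1 rather than A(v,v) covers the case A(v,v) = 0. *)
  have := Apos ((bform A v v + 1) *: u - bform A u v *: v).
  rewrite -scaleNr !(bformDl, bformDr, bformZl, bformZr) Au0.
  rewrite (bform_sym v u As); set b := bform A u v; set a := bform A v v => H.
  have : (a + 2) * b ^+ 2 <= 0 by nra.
  rewrite pmulr_rle0 ?ltr_wpDl// => b2.
  by apply/eqP; rewrite -sqrf_eq0 eq_le b2 sqr_ge0.
apply/rowP => j; have := orth (delta_mx 0 j).
by rewrite /bform trmx_delta -colE !mxE.
Qed.

Lemma det0_ex_ker A : \det A = 0 <-> exists2 u : 'rV[R]_N, u != 0 & u *m A = 0.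
Proof.
split=> [/eqP/det0P//|H]; apply/eqP/det0P; exact: H.
Qed.

(** The Rayleigh quotient is homogeneous of degree 0 and continuous off the
    origin, so it attains its minimum on the compact unit sphere (here that of
    the sup norm). *)
Lemma ex_min_rayleigh A B : (0 < N)%N ->
    (forall u, u != 0 -> 0 < bform B u u) ->
  exists k, (forall u, k * bform B u u <= bform A u u) /\
            exists2 u, u != 0 & k * bform B u u = bform A u u.
Proof.
move=> N0 Bpos; pose S := [set u : 'rV[R]_N | `|u| = 1]%classic.
have S0 : (S !=set0)%classic.
  pose e : 'rV[R]_N := const_mx 1.
  have e0 : e != 0.
    apply/eqP => /rowP /(_ (Ordinal N0)); rewrite !mxE => /eqP.
    by rewrite oner_eq0.
  exists (`|e|^-1 *: e); rewrite /S /= normrZ normfV normr_id mulVf //.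
  by rewrite normr_eq0.
have Sc : compact S.
  apply: bounded_closed_compact.
    exists 1; split; first by rewrite num_real.
    by move=> M M1 u; rewrite /S /= => ->; rewrite ltW.
  rewrite (_ : S = ((@Num.norm _ 'rV[R]_N) @^-1` [set 1])%classic); last by [].
  apply: closed_comp; last exact: closed_eq.
  by move=> u _; exact: norm_continuous.
have Sn u : S u -> u != 0.
  move=> Su; apply/eqP => u0; move: Su; rewrite u0 /S /= normr0.
  by move=> /esym/eqP; rewrite oner_eq0.
pose q u := bform A u u / bform B u u.
have cq : {within S, continuous q}.
  apply: (@continuous_in_subspaceT _ _ S q) => u /set_mem /Sn u0.
  apply: (@continuousM R 'rV[R]_N (fun u => bform A u u)
    (fun u => (bform B u u)^-1)); first exact: bform_continuous.
  apply: (@continuousV R 'rV[R]_N (fun u => bform B u u)).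
    by rewrite gt_eqF// Bpos.
  exact: bform_continuous.
have [u0 /set_mem Su0 qmin] := EVT_min_rV S0 Sc cq.
exists (q u0); split; last first.
  exists u0; first exact: Sn.
  by rewrite /q divfK// gt_eqF// Bpos// Sn.
move=> u; have [->|un0] := eqVneq u 0.
  by rewrite !bform0 mulr0.
have nu : `|u| != 0 by rewrite normr_eq0.
have := qmin (`|u|^-1 *: u); rewrite inE /S /= => /(_ _)/wrap[].
  by rewrite normrZ normfV normr_id mulVf.
rewrite {2}/q !(bformZl, bformZr) => h; rewrite -ler_pdivlMr ?Bpos//.
apply: (le_trans h); rewrite le_eqVlt; apply/orP; left; apply/eqP.
have := Bpos _ un0; move/gt_eqF/negbT => Bn; field; by rewrite nu Bn.
Qed.

(** At a minimiser [u] of the Rayleigh quotient, [A - k * B] is semidefinite and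
    isotropic, hence singular; conversely a kernel vector of [A - l * B] has
    Rayleigh quotient [l], so no root is below the minimum. *)
Lemma pencil_min_eigenvalue A B : (0 < N)%N -> A^T = A -> B^T = B ->
    (forall u, u != 0 -> 0 < bform B u u) ->
  exists k, is_greatest [set l | forall u, l * bform B u u <= bform A u u]%classic k
    /\ is_min_gen_eigenvalue A B k.
Proof.
move=> N0 As Bs Bpos; have [k [kle [u un0 ku]]] := ex_min_rayleigh A N0 Bpos.
exists k; split; split => //.
- by move=> l /= /(_ u); rewrite -ku ler_pM2r// Bpos.
- apply/det0_ex_ker; exists u => //; apply: psd_isotropic_ker => //.
  + by rewrite linearB /= linearZ /= As Bs.
  + by move=> v; rewrite bform_pencil subr_ge0.
  + by rewrite bform_pencil ku subrr.
- move=> l /= /det0_ex_ker[v v0 vk]; rewrite -(ler_pM2r (Bpos _ v0)).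
  rewrite (le_trans (kle v))// -subr_le0 -bform_pencil.
  by rewrite /bform vk mul0mx mxE.
Qed.

End SymmetricPencils.

(** * Substitutions on the punctured line *)

Section Punctured.
Local Open Scope classical_set_scope.
Local Open Scope ring_scope.
Context {R : realType}.
Local Notation mu := (@lebesgue_measure R).
Local Notation D0 := (~` [set 0 : R]).

Lemma measurable_punctured : measurable (D0 : set (measurableTypeR R)).
Proof. exact: measurableC. Qed.

Lemma measurable_dilation (a : R) :
  measurable_fun [set: measurableTypeR R]
    ( *%R a : measurableTypeR R -> measurableTypeR R).
Proof. exact: mulrl_measurable. Qed.

Lemma lebesgue_measure_dilation (a : {posnum R}) (A : set R) : measurable A ->
  mu A = (a%:num%:E *
    pushforward mu ( *%R a%:num : measurableTypeR R -> measurableTypeR R) A)%E.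
Proof.
move=> mA.
apply: (lebesgue_measure_unique (mu := mscale (a%:num%:nng)
  (measure_function_pushforward__canonical__measure_function_Measure mu
     (measurable_dilation a%:num)))) => // _ [[u v]] _ <-.
change (mu `]u, v]%classic = a%:num%:E * mu ( *%R a%:num @^-1` `]u, v]%classic))%E.
rewrite [X in (_ * mu X)%E](_ : _ = `]u / a%:num, v / a%:num]%classic); last first.
  apply/seteqP; split => x /=; rewrite !in_itv /= ltr_pdivrMr// ler_pdivlMr//;
   by rewrite mulrC.
rewrite !lebesgue_measure_itv /= !lte_fin ltr_pM2r ?invr_gt0//.
case: ifPn => _; last by rewrite mule0.
by rewrite -!EFinB -EFinM -mulrBl mulrC divfK.
Qed.

(** Stated on the punctured line, which dilations preserve, because the Lévy
    density is only meaningful off the origin. *)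
Lemma ge0_integral_punctured_scale (a : R) (f : R -> \bar R) : 0 < a ->
  measurable_fun D0 f -> (forall z, z != 0 -> (0 <= f z)%E) ->
  (\int[mu]_(z in D0) f z = a%:E * \int[mu]_(z in D0) f (a * z)%R)%E.
Proof.
move=> a0 mf f0; pose a' := PosNum a0.
have -> : (\int[mu]_(z in D0) f (a * z)%R =
   \int[mu]_(z in ( *%R a : measurableTypeR R -> measurableTypeR R) @^-1` D0)
     (f \o *%R a) z)%E.
  congr integral; apply/seteqP; split => x /=; apply: contra_not.
    by move/eqP; rewrite mulf_eq0 gt_eqF//= => /eqP.
  by move=> ->; rewrite mulr0.
have f0' : {in D0, forall y, 0 <= f y}%E by move=> y; rewrite inE => /eqP; exact: f0.
pose push := measure_function_pushforward__canonical__measure_function_Measure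
  mu (measurable_dilation a).
pose k := NngNum (ltW a0).
transitivity (\int[mscale k push]_(z in D0) f z)%E.
  by apply: eq_measure_integral => A mA _; exact: (lebesgue_measure_dilation a').
rewrite ge0_integral_mscale//; last by move=> y /eqP; exact: f0.
congr (_ * _)%E.
  exact: (ge0_integral_pushforward (measurable_dilation a) mu
    measurable_punctured mf f0').
exact: measurable_punctured.
Qed.

Lemma ge0_integral_punctured_opp (f : R -> \bar R) :
  measurable_fun D0 f -> (forall z, z != 0 -> (0 <= f z)%E) ->
  (\int[mu]_(z in D0) f z = \int[mu]_(z in D0) f (- z)%R)%E.
Proof.
move=> mf f0.
have -> : (\int[mu]_(z in D0) f (- z)%R =
   \int[mu]_(z in (-%R : measurableTypeR R -> measurableTypeR R) @^-1` D0)
     (f \o -%R) z)%E.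
  congr integral.
  apply/seteqP; split => x /= /eqP x0; apply/eqP; first by rewrite oppr_eq0.
  by move: x0; rewrite oppr_eq0.
rewrite -ge0_integral_pushforward//; last 2 first.
- exact: measurable_punctured.
- by move=> y; rewrite inE => /eqP; exact: f0.
by apply: eq_measure_integral => A mA _; exact/esym/lebesgue_measureN.
Qed.

(** By reflection the positive and negative parts have the same integral [s];
    when [s] is infinite, [s - s] is an infinite value, read as 0 in the reals. *)
Lemma Rintegral_punctured_odd (f : R -> R) :
  measurable_fun D0 f -> (forall z, f (- z) = - f z) ->
  \int[mu]_(z in D0) f z = 0.
Proof.
move=> mf fodd; rewrite /Rintegral integralE.
have mEf : measurable_fun D0 (EFin \o f) by exact/measurable_EFinP.
rewrite (_ : (\int[mu]_(x in D0) (fun x => (f x)%:E)^\- x)%E =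
  (\int[mu]_(x in D0) (fun x => (f x)%:E)^\+ x)%E).
  by case: (integral _ _ _) => // r; rewrite /= subrr.
rewrite [RHS]ge0_integral_punctured_opp//; last exact: measurable_funepos.
by apply: eq_integral => z _; rewrite funenegE funeposE fodd.
Qed.

End Punctured.

(** * The normalising constant of the Lévy measure *)

Section LevyMeasure.
Local Open Scope classical_set_scope.
Local Open Scope ring_scope.
Context {R : realType}.
Local Notation mu := (@lebesgue_measure R).
Local Notation D0 := (~` [set 0 : R]).

Lemma integral_powR (a b p : R) : 0 < a -> a < b -> p != 0 ->
  (\int[mu]_(z in `[a, b]) (z `^ (p - 1))%:E)%E = ((b `^ p - a `^ p) / p)%:E.
Proof.
move=> a0 ab p0.
have pos z : z \in `[a, b] -> 0 < z.
  by rewrite in_itv /= => /andP[az _]; exact: lt_le_trans az.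
have dpow (q z : R) : 0 < z -> derivable (@powR R ^~ q) z 1.
  by move=> z0; apply: derivable_powR; rewrite in_itv/= andbT.
have cpow (q z : R) : 0 < z -> {for z, continuous (@powR R ^~ q)}.
  move=> z0; apply: differentiable_continuous; apply/derivable1_diffP.
  exact: dpow.
have dF (z : R) : 0 < z -> is_derive z 1 (fun z => p^-1 * z `^ p) (z `^ (p - 1)).
  move=> z0; have dz := is_derive1_powR p z0.
  by apply: is_derive_eq; rewrite /GRing.scale /= mulrA mulVf// mul1r.
have cF z : 0 < z -> {for z, continuous (fun z => p^-1 * z `^ p)}.
  by move=> z0; apply: cvgM; [exact: cvg_cst|exact: cpow].
rewrite (@continuous_FTC2 _ _ (fun z => p^-1 * z `^ p))//.
- by rewrite -EFinB mulrBl ![p^-1 * _]mulrC.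
- by apply: continuous_in_subspaceT => z /set_mem /pos; exact: cpow.
- split.
  + by move=> z /subset_itv_oo_cc /pos /dF; case.
  + by apply: cvg_at_right_filter; exact: cF.
  + by apply: cvg_at_left_filter; apply: cF; exact: lt_trans ab.
- by move=> z /subset_itv_oo_cc /pos /dF[_ <-]; rewrite derive1E.
Qed.

Lemma one_sub_cos_ge0 (x : R) : 0 <= 1 - cos x.
Proof. by rewrite subr_ge0 cos_le1. Qed.

Lemma sin_le (x : R) : 0 <= x -> sin x <= x.
Proof.
move=> x0; have [c _] := @MVT_segment R sin cos 0 x x0
  (fun z _ => is_derive_sin z) (continuous_subspaceT (@continuous_sin R)).
by rewrite sin0 !subr0 => ->; rewrite ler_piMl// cos_le1.
Qed.

Lemma one_sub_cos_le (x : R) : 0 <= x -> 1 - cos x <= x ^+ 2.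
Proof.
move=> x0; have cN : continuous (fun z : R => - cos z).
  by move=> z; apply: continuousN; exact: continuous_cos.
have [c /itvP c0x] := @MVT_segment R (fun z => - cos z) sin 0 x x0
  (fun z _ => is_derive_eq (is_deriveN (is_derive_cos z)) (opprK _))
  (continuous_subspaceT cN).
rewrite cos0 opprK subr0 addrC => ->; rewrite expr2 ler_wpM2r//.
by rewrite (le_trans (sin_le _))// ?c0x.
Qed.

(** The integrand of the Lévy-Khintchine formula at frequency [xi], before
    normalisation. *)
Definition levy_kernel (gamma xi z : R) : R :=
  (1 - cos (xi * z)) * `|z| `^ (- 1 - gamma).

Lemma levy_kernel_ge0 gamma xi z : 0 <= levy_kernel gamma xi z.
Proof. by rewrite mulr_ge0 ?one_sub_cos_ge0 ?powR_ge0. Qed.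

Lemma measurable_levy_power (gamma : R) (A : set R) :
  measurable_fun A (fun z => `|z| `^ (- 1 - gamma)).
Proof.
apply: measurable_funTS.
by apply: (measurableT_comp (f := @powR R ^~ (- 1 - gamma))).
Qed.

Lemma measurable_levy_density (gamma : R) (A : set R) :
  measurable_fun A (levy_density gamma).
Proof. by apply: measurable_funM => //; exact: measurable_levy_power. Qed.

Lemma measurable_levy_kernel gamma xi (A : set R) :
  measurable_fun A (levy_kernel gamma xi).
Proof.
apply: measurable_funM; last exact: measurable_levy_power.
apply: measurable_funTS; apply: measurable_funB => //.
apply: (measurableT_comp (f := @cos R)); last exact: mulrl_measurable.
by apply: continuous_measurable_fun => z; exact: continuous_cos.
Qed.

Variable gamma : R.
Hypothesis g02 : 0 < gamma < 2.
Local Notation h := (fun z : R => (levy_kernel gamma 1 z)%:E).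

Let g0 : 0 < gamma. Proof. by case/andP: g02. Qed.
Let g2 : gamma < 2. Proof. by case/andP: g02. Qed.

Let h0 z : (0 <= h z)%E. Proof. by rewrite lee_fin levy_kernel_ge0. Qed.

Let mh (A : set R) : measurable_fun A h.
Proof. by apply/measurable_EFinP; exact: measurable_levy_kernel. Qed.

(** Near 0 the kernel is at most [z^(1-gamma)], integrable because
    [gamma < 2]; at infinity it is at most [2 z^(-1-gamma)], integrable because
    [0 < gamma].  Compact intervals keep the primitives away from the
    singularity of the powers at 0. *)
Lemma le_integral_levy_itv (a b : R) : 0 < a < 1 -> 1 < b ->
  (\int[mu]_(z in `[a, b]) h z <= ((2 - gamma)^-1 + 2 / gamma)%:E)%E.
Proof.
move=> /andP[a0 a1] b1.
have mp (A : set R) q : measurable_fun A (fun z : R => (z `^ q)%:E).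
  by apply/measurable_EFinP/measurable_funTS; exact: measurable_powR.
rewrite (@itv_bndbnd_setU _ _ (BLeft a) (BRight 1) (BRight b))//; last 2 first.
- by rewrite bnd_simp ltW.
- by rewrite bnd_simp ltW.
rewrite ge0_integral_setU//; last first.
- apply/disj_setPRL => z /=; rewrite !in_itv /= => /andP[z1 _].
  by move=> /andP[_]; rewrite leNgt z1.
- exact: mh.
rewrite EFinD; apply: leeD.
- apply: (@le_trans _ _
    (\int[mu]_(z in `[a, 1%R]) (z `^ ((2 - gamma) - 1))%:E)%E).
    apply: ge0_le_integral;
      [exact: measurable_itv|by move=> z _; exact: h0|exact: mh|exact: mp|].
    move=> z /=; rewrite in_itv /= => /andP[az z1].
    have z0 : 0 < z by exact: lt_le_trans az.
    rewrite lee_fin /levy_kernel mul1r gtr0_norm//.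
    rewrite (_ : 2 - gamma - 1 = 2 + (- 1 - gamma)); last by ring.
    rewrite [leRHS]powRD; last by rewrite (gt_eqF z0) implybT.
    by rewrite ler_wpM2r ?powR_ge0// powR_mulrn ?one_sub_cos_le// ltW.
  rewrite integral_powR//; last by rewrite subr_eq0 gt_eqF.
  rewrite powR1 lee_fin ler_pdivrMr ?subr_gt0// mulVf ?subr_eq0 ?gt_eqF//.
  by rewrite gerBl powR_ge0.
- rewrite integral_itv_obnd_cbnd//.
  apply: (@le_trans _ _
    (\int[mu]_(z in `[1%R, b]) (2%:E * (z `^ (- gamma - 1))%:E))%E).
    apply: ge0_le_integral;
      [exact: measurable_itv|by move=> z _; exact: h0|exact: mh|
       by apply: measurable_funeM; exact: mp|].
    move=> z /=; rewrite in_itv /= => /andP[z1 _].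
    have z0 : 0 < z by exact: lt_le_trans z1.
    rewrite -EFinM lee_fin /levy_kernel mul1r gtr0_norm// (addrC (- gamma)).
    by rewrite ler_wpM2r ?powR_ge0//; have := cos_geN1 z; lra.
  rewrite ge0_integralZl//; [|exact: mp|by move=> z _; rewrite lee_fin powR_ge0].
  rewrite integral_powR// ?oppr_eq0 ?gt_eqF// powR1 -EFinM lee_fin.
  rewrite invrN mulrN -mulNr opprB ler_wpM2l// ler_piMl ?invr_ge0 ?(ltW g0)//.
  by rewrite gerBl powR_ge0.
Qed.

Lemma le_integral_levy_oo :
  (\int[mu]_(z in `]0%R, +oo[) h z <= ((2 - gamma)^-1 + 2 / gamma)%:E)%E.
Proof.
(* The index starts at 2 so that 1 is interior to every interval. *)
pose F n := `[(n.+2%:R : R)^-1, n.+2%:R]%classic.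
have Fu : `]0%R, +oo[%classic = \bigcup_n F n.
  apply/seteqP; split => z /=; rewrite in_itv /= ?andbT; last first.
    move=> [n _]; rewrite /F /= in_itv/= => /andP[+ _].
    by apply: lt_le_trans; rewrite invr_gt0.
  move=> z0; exists (Num.truncn (z + z^-1)) => //; rewrite /F/= in_itv /=.
  have zz := truncnS_gt (z + z^-1).
  have zi0 : 0 < z^-1 by rewrite invr_gt0.
  have nn : (Num.truncn (z + z^-1)).+1%:R <= (Num.truncn (z + z^-1)).+2%:R :> R.
    by rewrite ler_nat.
  rewrite invf_ple ?posrE//; apply/andP; split;
    apply: le_trans nn; apply/ltW; apply: lt_trans zz.
    by rewrite ltrDr.
  by rewrite ltrDl.
have ndF : nondecreasing_seq F.
  move=> m n mn; apply/subsetPset => z; rewrite /F /= !in_itv /= => /andP[mz zm].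
  apply/andP; split.
    by apply: le_trans mz; rewrite lef_pV2 ?posrE// ler_nat.
  by apply: le_trans zm _; rewrite ler_nat.
have mF n : measurable (F n : set (measurableTypeR R)) by exact: measurable_itv.
have mhF n : measurable_fun (F n : set (measurableTypeR R)) h by exact: mh.
have hF0 n z : F n z -> (0 <= h z)%E by move=> _; exact: h0.
rewrite Fu.
have /cvg_lim <-// := ge0_nondecreasing_set_cvg_integral (mu := mu) ndF mF mhF hF0.
apply: lime_le.
  apply: ereal_nondecreasing_is_cvgn.
  exact: ge0_nondecreasing_set_nondecreasing_integral.
apply: nearW => n; apply: le_integral_levy_itv => //.
  by rewrite invr_gt0 ltr0n /= invf_lt1 ?ltr1n.
by rewrite ltr1n.
Qed.

(** The kernel is even, hence bounded by the sum of its restriction to the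
    positive half-line and of the reflection of that restriction. *)
Lemma integral_levy_lty : (\int[mu]_(z in D0) h z < +oo)%E.
Proof.
pose k := (h : R -> \bar R) \_ `]0%R, +oo[.
have k0 z : (0 <= k z)%E by apply: erestrict_ge0 => y _; exact: h0.
have mk : measurable_fun setT k by apply/(measurable_restrictT _ _).1.
have mkN : measurable_fun setT (fun z : R => k (- z)%R).
  by apply: (measurableT_comp mk).
have kfin : (\int[mu]_(z in D0) k z < +oo)%E.
  rewrite -integral_mkcondr (_ : _ `&` _ = `]0%R, +oo[%classic).
    exact: le_lt_trans le_integral_levy_oo (ltry _).
  rewrite setIC; apply: setIidl => z /=; rewrite in_itv /= andbT => z0 z1.
  by move: z0; rewrite z1 ltxx.
apply: (@le_lt_trans _ _ (\int[mu]_(z in D0) (k z + k (- z)%R))%E).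
  apply: ge0_le_integral;
    [exact: measurable_punctured|by move=> z _; exact: h0|exact: mh| |].
  - by apply: emeasurable_funD; apply: measurable_funTS.
  - move=> z /= /eqP; rewrite neq_lt => /orP[] z0.
      rewrite [k (- z)]patchE mem_set/=; last by rewrite in_itv/= andbT oppr_gt0.
      have -> : levy_kernel gamma 1 (- z) = levy_kernel gamma 1 z.
        by rewrite /levy_kernel !mul1r cosN normrN.
      exact: leeDr.
    by rewrite [k z]patchE mem_set/=; [rewrite leeDl|rewrite in_itv/= z0].
rewrite ge0_integralD//; first last.
- exact: measurable_funTS.
- exact: measurable_funTS.
- exact: measurable_punctured.
rewrite -[X in (_ + X)%E](ge0_integral_punctured_opp (f := k))//;
  last exact: measurable_funTS.
exact: lte_add_pinfty.
Qed.

(** On [[1, 2]] the kernel is bounded below by a positive constant, since [cos]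
    decreases on [[0, pi]] and [2 <= pi]. *)
Lemma integral_levy_gt0 : (0 < \int[mu]_(z in D0) h z)%E.
Proof.
pose m : R := (1 - cos 1) * 2 `^ (- 1 - gamma).
have pi2 : 2 <= pi :> R := pi_ge2 R.
have m0 : 0 < m.
  rewrite mulr_gt0 ?powR_gt0// subr_gt0 -[X in _ < X]cos0 ltr_cos ?ltr01//
    in_itv /= ?lexx ?ler01 ?pi_ge0//=; lra.
have le1 : (\int[mu]_(z in `[1%R, 2%R]) (cst m%:E z) <=
            \int[mu]_(z in `[1%R, 2%R]) h z)%E.
  apply: ge0_le_integral;
    [exact: measurable_itv|by move=> z _; rewrite lee_fin ltW|
     exact: measurable_cst|exact: mh|].
  move=> z /=; rewrite in_itv /= => /andP[z1 z2].
  have z0 : 0 < z by lra.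
  rewrite lee_fin /levy_kernel mul1r ler_pM// ?one_sub_cos_ge0 ?powR_ge0//.
    rewrite lerD2l lerN2; move: z1; rewrite le_eqVlt => /predU1P[->//|z1].
    by rewrite ltW// ltr_cos ?in_itv/=//; apply/andP; split; lra.
  rewrite gtr0_norm// (_ : - 1 - gamma = - (1 + gamma)); last by ring.
  by rewrite !powRN lef_pV2 ?posrE ?powR_gt0// ge0_ler_powR// ?nnegrE;
    have := g0; lra.
have le2 : (\int[mu]_(z in `[1%R, 2%R]) h z <= \int[mu]_(z in D0) h z)%E.
  apply: ge0_subset_integral;
    [exact: measurable_itv|exact: measurable_punctured|exact: mh|
     by move=> z _; exact: h0|].
  move=> z /=; rewrite in_itv /= => /andP[z1 _] z0; move: z1; rewrite z0; lra.
apply: lt_le_trans (le_trans le1 le2).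
rewrite integral_cst//= lebesgue_measure_itv/= lte_fin ltr1n -EFinB -EFinM lte_fin.
by rewrite mulr_gt0//; lra.
Qed.

(** Dilating by [|xi|] shows that the integral at frequency [xi] is
    [|xi|^gamma] times the one at frequency 1, so the constant is the inverse of
    the latter.  Being nonempty, the set that [levy_const] selects from contains
    the selected value. *)
Lemma levy_const_spec :
  0 < levy_const gamma /\ forall xi : R, (`|xi| `^ gamma)%:E =
    (\int[mu]_(z in D0) ((1 - cos (xi * z)) * levy_density gamma z)%:E)%E.
Proof.
rewrite /levy_density /levy_const; set P := (X in xget _ X).
suff : P !=set0 by case=> d Pd; exact: (xgetPex 0 (ex_intro P d Pd)).
have I0 := integral_levy_gt0; have Ioo := integral_levy_lty.
pose I := (\int[mu]_(z in D0) h z)%E; rewrite -/I in I0 Ioo.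
have [k k0 kI] : exists2 k : R, 0 < k & (k%:E * I = 1)%E.
  have If : I = (fine I)%:E by rewrite fineK// ge0_fin_numE// ltW.
  have fI0 : 0 < fine I by rewrite fine_gt0// I0 Ioo.
  exists (fine I)^-1; first by rewrite invr_gt0.
  by rewrite [X in (_ * X)%E]If -EFinM mulVf// gt_eqF.
exists k; split => // xi; have [->|xi0] := eqVneq xi 0.
  rewrite normr0 powR0 ?gt_eqF// integral0_eq// => z _.
  by rewrite mul0r cos0 subrr mul0r.
pose a := `|xi|; have a0 : 0 < a by rewrite normr_gt0.
transitivity ((a `^ gamma)%:E * (k%:E * I))%E; first by rewrite kI mule1.
rewrite /I (ge0_integral_punctured_scale (f := h) a0 (@mh _) (fun z _ => @h0 z)).
rewrite !muleA -!EFinM -ge0_integralZl; first last.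
- by rewrite lee_fin !mulr_ge0 ?powR_ge0 ?(ltW a0) ?(ltW k0).
- by move=> z _; exact: h0.
- by apply: (measurableT_comp (f := h) (@mh setT)); exact: mulrl_measurable.
- exact: measurable_punctured.
apply: eq_integral => z _; rewrite /levy_kernel -EFinM; congr EFin.
rewrite mul1r normrM (gtr0_norm a0) (powRM _ (ltW a0) (normr_ge0 z)).
have -> : cos (a * z) = cos (xi * z).
  by rewrite /a; case: (ger0P xi) => // _; rewrite mulNr cosN.
have e : a `^ gamma * a * a `^ (- 1 - gamma) = 1.
  rewrite -{2}(powRr1 (ltW a0)) -!powRD ?(gt_eqF a0) ?implybT//.
  by rewrite (_ : gamma + 1 + (- 1 - gamma) = 0) ?powRr0//; ring.
by rewrite -[RHS]mul1r -[X in _ = X * _]e; ring.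
Qed.

End LevyMeasure.

(** * Fourier modes and complex-valued integrals *)

Section ComplexIntegral.
Local Open Scope classical_set_scope.
Local Open Scope complex_scope.
Local Open Scope ring_scope.
Context {R : realType}.
Local Notation mu := (@lebesgue_measure R).
Implicit Types (n m : int) (x z : R).

Lemma conj_complex (a b : R) : Num.conj (a +i* b) = a +i* (- b).
Proof. by []. Qed.

Lemma fourier_modeD n m x :
  fourier_mode (n + m) x = fourier_mode n x * fourier_mode m x.
Proof.
rewrite /fourier_mode intrD mulrDl cosD sinD; apply/eqP.
by rewrite eq_complex /= eqxx /= addrC [X in X + _]mulrC eqxx.
Qed.

Lemma fourier_mode_add n x z :
  fourier_mode n (x + z) = fourier_mode n x * fourier_mode n z.
Proof.
rewrite /fourier_mode mulrDr cosD sinD; apply/eqP.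
by rewrite eq_complex /= eqxx /= addrC [X in X + _]mulrC eqxx.
Qed.

Lemma fourier_modeN n x : fourier_mode (- n) x = Num.conj (fourier_mode n x).
Proof. by rewrite /fourier_mode conj_complex mulrNz mulNr cosN sinN. Qed.

Lemma fourier_modeB n m x :
  fourier_mode (n - m) x = fourier_mode n x * Num.conj (fourier_mode m x).
Proof. by rewrite fourier_modeD fourier_modeN. Qed.

Lemma fourier_mode_at0 n : fourier_mode n (0 : R) = 1.
Proof. by rewrite /fourier_mode mulr0 cos0 sin0. Qed.

Lemma fourier_mode0 x : fourier_mode 0 x = 1.
Proof. by rewrite /fourier_mode mul0r cos0 sin0. Qed.

(** Integrability of the real and imaginary parts is what makes [Cintegral]
    complex-linear. *)
Definition Cintegrable (D : set R) (F : R -> R[i]) :=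
  mu.-integrable D (EFin \o (fun z => complex.Re (F z))) /\
  mu.-integrable D (EFin \o (fun z => complex.Im (F z))).

Lemma complex_ReD (u v : R[i]) : complex.Re (u + v) = complex.Re u + complex.Re v.
Proof. by case: u v => [? ?] [? ?]. Qed.
Lemma complex_ImD (u v : R[i]) : complex.Im (u + v) = complex.Im u + complex.Im v.
Proof. by case: u v => [? ?] [? ?]. Qed.
Lemma complex_ReM (u v : R[i]) : complex.Re (u * v) =
  complex.Re u * complex.Re v - complex.Im u * complex.Im v.
Proof. by case: u v => [? ?] [? ?]. Qed.
Lemma complex_ImM (u v : R[i]) : complex.Im (u * v) =
  complex.Re u * complex.Im v + complex.Im u * complex.Re v.
Proof. by case: u v => [? ?] [? ?]. Qed.

Lemma CintegrableD D F G : measurable (D : set (measurableTypeR R)) ->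
  Cintegrable D F -> Cintegrable D G -> Cintegrable D (fun z => F z + G z).
Proof.
move=> mD [Fr Fi] [Gr Gi]; split.
  apply: (eq_integrable mD _ _ _ (integrableD mD Fr Gr)) => z _.
  by rewrite /= complex_ReD EFinD.
apply: (eq_integrable mD _ _ _ (integrableD mD Fi Gi)) => z _.
by rewrite /= complex_ImD EFinD.
Qed.

Lemma CintegralD D F G : measurable (D : set (measurableTypeR R)) ->
  Cintegrable D F -> Cintegrable D G ->
  Cintegral D (fun z => F z + G z) = Cintegral D F + Cintegral D G.
Proof.
move=> mD [Fr Fi] [Gr Gi]; apply/eqP; rewrite eq_complex /=.
under eq_Rintegral do rewrite complex_ReD.
under [X in _ && (X == _)]eq_Rintegral do rewrite complex_ImD.
by rewrite !RintegralD// !eqxx.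
Qed.

Lemma integrableZ D (k : R) (f : R -> R) : measurable (D : set (measurableTypeR R)) ->
  mu.-integrable D (EFin \o f) -> mu.-integrable D (EFin \o (fun z => k * f z)).
Proof.
by move=> mD mf; apply: (eq_integrable mD _ _ _ (integrableZl mD k mf)).
Qed.

Lemma CintegrableZ D (c : R[i]) F : measurable (D : set (measurableTypeR R)) ->
  Cintegrable D F -> Cintegrable D (fun z => c * F z).
Proof.
move=> mD [Fr Fi]; split.
  apply: (eq_integrable mD _ _ _ (integrableB mD (integrableZ (complex.Re c) mD Fr)
    (integrableZ (complex.Im c) mD Fi))) => z _.
  by rewrite /= complex_ReM EFinB.
apply: (eq_integrable mD _ _ _ (integrableD mD (integrableZ (complex.Re c) mD Fi)
  (integrableZ (complex.Im c) mD Fr))) => z _.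
by rewrite /= complex_ImM EFinD.
Qed.

Lemma CintegralZ D (c : R[i]) F : measurable (D : set (measurableTypeR R)) ->
  Cintegrable D F ->
  Cintegral D (fun z => c * F z) = c * Cintegral D F.
Proof.
move=> mD [Fr Fi]; apply/eqP; rewrite eq_complex /= complex_ReM complex_ImM /=.
under eq_Rintegral do rewrite complex_ReM.
under [X in _ && (X == _)]eq_Rintegral do rewrite complex_ImM.
rewrite RintegralB ?RintegralD//; try exact: integrableZ.
by rewrite !RintegralZl// !eqxx.
Qed.

Lemma Cintegral_lincomb (I : Type) (r : seq I) D (c : I -> R[i])
    (F : I -> R -> R[i]) : measurable (D : set (measurableTypeR R)) ->
  (forall i, Cintegrable D (F i)) ->
  Cintegrable D (fun z => \sum_(i <- r) c i * F i z) /\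
  Cintegral D (fun z => \sum_(i <- r) c i * F i z) =
    \sum_(i <- r) c i * Cintegral D (F i).
Proof.
move=> mD iF; elim: r => [|i r [IH1 IH2]].
  rewrite (_ : (fun z => _) = cst 0); last by apply/funext => z; rewrite big_nil.
  rewrite big_nil; split; first by split; exact: integrable0.
  by rewrite /Cintegral /= /Rintegral integral0.
rewrite (_ : (fun z => _) = fun z => c i * F i z + \sum_(i <- r) c i * F i z); last first.
  by apply/funext => z; rewrite big_cons.
rewrite big_cons; split; first by apply: CintegrableD => //; exact: CintegrableZ.
by rewrite CintegralD// ?IH2 ?CintegralZ//; exact: CintegrableZ.
Qed.

End ComplexIntegral.

(** * The carré du champ of trigonometric polynomials *)

Section GammaModes.
Local Open Scope classical_set_scope.
Local Open Scope complex_scope.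
Local Open Scope ring_scope.
Context {R : realType} (gamma : R).
Hypothesis g02 : 0 < gamma < 2.
Local Notation mu := (@lebesgue_measure R).
Local Notation D0 := (~` [set 0 : R]).
Local Notation dens := (levy_density gamma).

(** The eigenvalue of [- L_gamma] at the mode [n]. *)
Definition mode_symbol (n : int) : R := `|n|%N%:R `^ gamma.

(** Covariance of fractional Brownian motion of Hurst index [gamma / 2], extended
    to integer times of either sign. *)
Definition mode_cov (n m : int) : R :=
  2^-1 * (mode_symbol n + mode_symbol m - mode_symbol (n - m)).

Lemma mode_symbolE n : mode_symbol n = `|n%:~R| `^ gamma.
Proof. by rewrite /mode_symbol natr_absz intr_norm. Qed.

Lemma levy_density_ge0 z : 0 <= dens z.
Proof.
by rewrite mulr_ge0 ?powR_ge0//; have [/ltW] := levy_const_spec g02.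
Qed.

Lemma levy_cos_integrable (n : int) :
  mu.-integrable D0 (EFin \o (fun z => (1 - cos (n%:~R * z)) * dens z)).
Proof.
apply/integrableP; split.
  apply/measurable_EFinP; rewrite (_ : (fun z => _) =
      fun z => levy_const gamma * levy_kernel gamma n%:~R z).
    by apply: measurable_funM => //; exact: measurable_levy_kernel.
  by apply/funext => z; rewrite mulrCA.
have pos (z : R) : 0 <= (1 - cos (n%:~R * z)) * dens z.
  by rewrite mulr_ge0 ?one_sub_cos_ge0// levy_density_ge0.
under eq_integral do rewrite /= ger0_norm//.
by have [_ <-] := levy_const_spec g02; rewrite ltry.
Qed.

Lemma levy_cos_Rintegral (n : int) :
  \int[mu]_(z in D0) ((1 - cos (n%:~R * z)) * dens z) = mode_symbol n.
Proof.
by rewrite mode_symbolE /Rintegral; have [_ <-] := levy_const_spec g02.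
Qed.

Definition mode_kernel (n m : int) (z : R) : R[i] :=
  (fourier_mode n z - 1) * (fourier_mode m z - 1)^* * (dens z)%:C.

Lemma mode_kernelE n m z : mode_kernel n m z =
  (((1 - cos (n%:~R * z)) * dens z + (1 - cos (m%:~R * z)) * dens z
    - (1 - cos ((n - m)%:~R * z)) * dens z)
  +i* ((sin ((n - m)%:~R * z) - sin (n%:~R * z) + sin (m%:~R * z)) * dens z)).
Proof.
rewrite /mode_kernel /fourier_mode intrB (mulrBl z) cosB sinB.
apply/eqP; rewrite eq_complex /=; apply/andP; split; apply/eqP; ring.
Qed.

(** Each of the three cosine terms integrates to a power by the normalisation of
    the density, and the sine terms are odd.  Their integrability is separate,
    since [sin (n z)] alone need not be integrable against the density: the
    imaginary part of [u * conj v] is at most [(|u|^2 + |v|^2) / 2], and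
    [|e_n - 1|^2 / 2] is [1 - cos]. *)
Lemma mode_kernel_integral n m :
  Cintegrable D0 (mode_kernel n m) /\
  Cintegral D0 (mode_kernel n m) = (2 * mode_cov n m)%:C.
Proof.
have mD0 := @measurable_punctured R.
have i3 := integrableB mD0 (integrableD mD0 (levy_cos_integrable n)
     (levy_cos_integrable m)) (levy_cos_integrable (n - m)).
have mIm : measurable_fun D0 (fun z =>
    (sin ((n - m)%:~R * z) - sin (n%:~R * z) + sin (m%:~R * z)) * dens z).
  have msin (k : int) : measurable_fun setT (fun z : R => sin (k%:~R * z)).
    apply: (measurableT_comp (f := @sin R)); last exact: mulrl_measurable.
    by apply: continuous_measurable_fun => z; exact: continuous_sin.
  apply: measurable_funTS; apply: measurable_funM.
    by apply: measurable_funD => //; apply: measurable_funB.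
  exact: measurable_levy_density.
split; [split|].
- apply: (eq_integrable mD0 _ _ _ i3) => z _.
  by rewrite /comp mode_kernelE /= !(EFinD, EFinN).
- under [X in integrable _ _ X]eq_fun do rewrite /comp mode_kernelE /=.
  apply: (le_integrable mD0 _ _
    (integrableD mD0 (levy_cos_integrable n) (levy_cos_integrable m))).
    exact/measurable_EFinP.
  move=> z _ /=; rewrite lee_fin -mulrDl normrM [leRHS]ger0_norm; last first.
    by rewrite mulr_ge0 ?levy_density_ge0// addr_ge0 ?one_sub_cos_ge0.
  rewrite (ger0_norm (levy_density_ge0 z)) ler_wpM2r ?levy_density_ge0//.
  rewrite intrB (mulrBl z) sinB.
  have := cos2Dsin2 (n%:~R * z); have := cos2Dsin2 (m%:~R * z).
  set a := cos _; set b := sin _; set c := cos _; set d := sin _ => h1 h2.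
  (* With u = e_n - 1 and v = e_m - 1, these squares add up to
     |u|^2 + |v|^2 plus or minus 2 Im (u * conj v). *)
  have := (sqr_ge0 (d - (a - 1)), sqr_ge0 (c - 1 + b)).
  have := (sqr_ge0 (d + (a - 1)), sqr_ge0 (c - 1 - b)) => -[p1 p2] [p3 p4].
  rewrite ler_norml; apply/andP; split; nra.
- rewrite /Cintegral; congr Complex.
    under eq_Rintegral do rewrite mode_kernelE /=.
    rewrite RintegralB//;
      [|exact: integrableD (levy_cos_integrable n) (levy_cos_integrable m)
       |exact: levy_cos_integrable].
    rewrite RintegralD//; try exact: levy_cos_integrable.
    by rewrite !levy_cos_Rintegral /mode_cov mulrA mulfV ?mul1r.
  under eq_Rintegral do rewrite mode_kernelE /=.
  apply: Rintegral_punctured_odd => // z.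
  by rewrite !mulrN !sinN /levy_density normrN; ring.
Qed.

(** The frequencies are indexed by an arbitrary finite type and may repeat, so
    that products of trigonometric polynomials, with frequencies [k i - l j]
    indexed by pairs, are again of this form. *)
Definition trig_poly (I : finType) (k : I -> int) (a : I -> R[i]) : R -> R[i] :=
  fun x => \sum_i a i * fourier_mode (k i) x.

Lemma carre_du_champ_integrand_trig (I J : finType) (k : I -> int) (l : J -> int)
    a b x z :
  (trig_poly k a (x + z) - trig_poly k a x) *
    (trig_poly l b (x + z) - trig_poly l b x)^* * (dens z)%:C =
  \sum_(p : I * J) a p.1 * fourier_mode (k p.1) x *
    Num.conj (b p.2 * fourier_mode (l p.2) x) * mode_kernel (k p.1) (l p.2) z.
Proof.
have shift (K : finType) (h : K -> int) (c : K -> R[i]) :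
    trig_poly h c (x + z) - trig_poly h c x =
    \sum_i c i * fourier_mode (h i) x * (fourier_mode (h i) z - 1).
  rewrite /trig_poly -sumrB; apply: eq_bigr => i _.
  by rewrite fourier_mode_add mulrBr mulr1 mulrA.
rewrite !shift rmorph_sum mulr_suml mulr_suml.
rewrite -(pair_big xpredT xpredT (fun i j => a i * fourier_mode (k i) x *
  Num.conj (b j * fourier_mode (l j) x) * mode_kernel (k i) (l j) z)) /=.
apply: eq_bigr => i _; rewrite mulr_sumr mulr_suml; apply: eq_bigr => j _.
by rewrite rmorphM /mode_kernel /=; ring.
Qed.

Lemma Cintegrable_carre_du_champ_trig (I J : finType) (k : I -> int) (l : J -> int)
    a b x :
  Cintegrable D0 (fun z => (trig_poly k a (x + z) - trig_poly k a x) *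
    (trig_poly l b (x + z) - trig_poly l b x)^* * (dens z)%:C).
Proof.
under eq_fun do rewrite carre_du_champ_integrand_trig.
apply: (Cintegral_lincomb _ _ measurable_punctured _).1 => p.
exact: (mode_kernel_integral _ _).1.
Qed.

Lemma carre_du_champ_trig (I J : finType) (k : I -> int) (l : J -> int) a b :
  carre_du_champ gamma (trig_poly k a) (trig_poly l b) =
  trig_poly (fun p : I * J => k p.1 - l p.2)
    (fun p => a p.1 * Num.conj (b p.2) * (mode_cov (k p.1) (l p.2))%:C).
Proof.
apply/funext => x; rewrite /carre_du_champ.
under [X in Cintegral _ X]eq_fun do rewrite carre_du_champ_integrand_trig.
rewrite (Cintegral_lincomb _ _ measurable_punctured
  (fun p => (mode_kernel_integral (k p.1) (l p.2)).1)).2.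
rewrite /trig_poly mulr_sumr; apply: eq_bigr => p _.
rewrite (mode_kernel_integral _ _).2 fourier_modeB rmorphM [(2 * _)%:C]rmorphM /=.
rewrite (_ : 2%:C = 2); last by rewrite rmorph_nat.
by field.
Qed.

End GammaModes.

(** * Fourier coefficients and the fractional Laplacian *)

Section FourierCoefficients.
Local Open Scope classical_set_scope.
Local Open Scope complex_scope.
Local Open Scope ring_scope.
Context {R : realType}.
Local Notation mu := (@lebesgue_measure R).
Implicit Types n m : int.

Lemma cos_sin_intr_2pi n :
  cos (n%:~R * (2 * pi)) = 1 :> R /\ sin (n%:~R * (2 * pi)) = 0 :> R.
Proof.
have nat_case (k : nat) :
    cos (k%:R * (2 * pi)) = 1 :> R /\ sin (k%:R * (2 * pi)) = 0 :> R.
  have -> : k%:R * (2 * pi) = 0 + pi *+ 2 *+ k :> R.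
    by rewrite add0r [2 * pi]mulr_natl mulr_natl.
  by rewrite (periodicn (@cosD2pi R)) (periodicn (@sinD2pi R)) cos0 sin0.
case: n => k; first exact: nat_case.
rewrite NegzE mulrNz mulNr cosN sinN; have [-> ->] := nat_case k.+1.
by rewrite oppr0.
Qed.

Lemma continuous_linear_trig n (f : R -> R) : continuous f ->
  continuous (fun x : R => f (n%:~R * x)).
Proof.
by move=> cf x; apply: continuous_comp; [exact: mulrl_continuous|exact: cf].
Qed.

Lemma integrable_mode n : Cintegrable `[0, 2 * pi]%classic (fourier_mode n : R -> _).
Proof.
split; apply: continuous_compact_integrable;
  try exact: segment_compact; apply: continuous_subspaceT;
  apply: continuous_linear_trig; [exact: continuous_cos|exact: continuous_sin].
Qed.

Lemma Rintegral_period (n : int) (F f : R -> R) : n != 0 ->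
  continuous f -> (forall x : R, is_derive x 1 F (f x)) ->
  F (n%:~R * (2 * pi)) = F 0 ->
  \int[mu]_(x in `[0, 2 * pi]) f (n%:~R * x) = 0.
Proof.
move=> n0 cf dF Fper; have nR0 : n%:~R != 0 :> R by rewrite intr_eq0.
pose G (x : R) := n%:~R^-1 * F (n%:~R * x).
have dG (x : R) : is_derive x 1 G (f (n%:~R * x)).
  have d1 : is_derive x 1 (fun x : R => n%:~R * x) n%:~R.
    by apply: is_derive_eq; rewrite /GRing.scale /= mulr1.
  have d2 := @is_derive1_comp R F (fun x : R => n%:~R * x) x
    (f (n%:~R * x)) n%:~R (dF _) d1.
  have d3 := @is_deriveZ _ _ _ _ n%:~R^-1 _ _ _ d2.
  by apply: (is_derive_eq d3); rewrite /GRing.scale /=; field.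
have cG : continuous G.
  by move=> x; apply/differentiable_continuous/derivable1_diffP; case: (dG x).
rewrite /Rintegral (@continuous_FTC2 _ _ G).
- by rewrite /G mulr0 Fper -EFinB subrr.
- by rewrite mulr_gt0// pi_gt0.
- by apply: continuous_subspaceT; exact: continuous_linear_trig.
- split; first by move=> x _; case: (dG x).
    by apply: cvg_at_right_filter; exact: cG.
  by apply: cvg_at_left_filter; exact: cG.
- by move=> x _; rewrite derive1E; case: (dG x).
Qed.

Lemma Cintegral_mode n :
  Cintegral `[0, 2 * pi]%classic (fourier_mode n : R -> _) =
  (2 * pi)%:C *+ (n == 0).
Proof.
have [->|n0] := eqVneq n 0.
  rewrite (_ : fourier_mode 0 = fun=> 1 : R[i]); last first.
    by apply/funext => x; exact: fourier_mode0.
  have l : lebesgue_measure (`[0, 2 * pi]%classic : set R) = (2 * pi)%:E.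
    by rewrite lebesgue_measure_itv /= lte_fin mulr_gt0 ?pi_gt0// -EFinB subr0.
  by rewrite /Cintegral /= !Rintegral_cst//= l /= mul1r mul0r mulr1n.
have [c1 s1] := cos_sin_intr_2pi n.
rewrite /Cintegral /= (@Rintegral_period n sin cos)//.
- have dNcos (x : R) : is_derive x 1 (fun x : R => - cos x) (sin x).
    by apply: is_derive_eq; rewrite opprK.
  rewrite (@Rintegral_period n (fun x => - cos x) sin)//.
  + exact: continuous_sin.
  + by rewrite c1 cos0.
- exact: continuous_cos.
- by rewrite s1 sin0.
Qed.

Lemma trig_poly_mul_mode (I : finType) (k : I -> int) (a : I -> R[i]) n x :
  trig_poly k a x * fourier_mode (- n) x =
  \sum_i a i * fourier_mode (k i - n) x.
Proof.
rewrite mulr_suml; apply: eq_bigr => i _.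
by rewrite fourier_modeD mulrA.
Qed.

Lemma Cintegrable_fourier_coef_trig (I : finType) (k : I -> int) (a : I -> R[i]) n :
  Cintegrable `[0, 2 * pi]%classic
    (fun x => trig_poly k a x * fourier_mode (- n) x).
Proof.
rewrite (_ : (fun x => _) =
    fun x : R => \sum_i a i * fourier_mode (k i - n) x); last first.
  by apply/funext => x; exact: trig_poly_mul_mode.
by apply: (Cintegral_lincomb _ _ (measurable_itv _) _).1 => i; exact: integrable_mode.
Qed.

Lemma fourier_coef_trig (I : finType) (k : I -> int) (a : I -> R[i]) n :
  fourier_coef (trig_poly k a) n = \sum_i a i *+ (k i == n).
Proof.
rewrite /fourier_coef.
rewrite (_ : (fun x => _) =
    fun x : R => \sum_i a i * fourier_mode (k i - n) x); last first.
  by apply/funext => x; exact: trig_poly_mul_mode.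
rewrite (Cintegral_lincomb _ _ (measurable_itv _) (fun i => integrable_mode _)).2.
rewrite mulr_sumr; apply: eq_bigr => i _.
rewrite Cintegral_mode subr_eq0; case: eqP => _; last by rewrite !mulr0n !mulr0.
have pi0 : 2 * pi != 0 :> R by rewrite mulf_neq0// gt_eqF// pi_gt0.
by rewrite !mulr1n mulrCA -rmorphM mulVf// mulr1.
Qed.

(** With repeated frequencies the coefficient at [n] collects all indices
    [i] with [k i = n], and exchanging the sums distributes it back. *)
Lemma frac_laplacian_trig (gamma : R) (I : finType) (k : I -> int) (a : I -> R[i]) :
  frac_laplacian gamma (trig_poly k a) =
  trig_poly k (fun i => (- mode_symbol gamma (k i))%:C * a i).
Proof.
apply/funext => x; rewrite /frac_laplacian.
pose r := undup (codom k).
have kr i : k i \in r by rewrite mem_undup codom_f.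
rewrite (fsbigE r) ?undup_uniq//; last first.
  move=> n _ nr; rewrite fourier_coef_trig.
  rewrite big1 ?mulr0 ?mul0r// => i _; case: eqP => [kin|_]; last by rewrite mulr0n.
  by rewrite -kin kr in nr.
under eq_bigl do rewrite in_setT.
under eq_bigr => n _ do rewrite fourier_coef_trig mulr_sumr mulr_suml.
rewrite exchange_big /=; apply: eq_bigr => i _.
rewrite (bigD1_seq (k i)) ?undup_uniq//= eqxx mulr1n big1 ?addr0//.
by move=> n /negPf nk; rewrite eq_sym nk mulr0n mulr0 mul0r.
Qed.

(** The three terms contribute the factors [- |n-m|^gamma], [|m|^gamma] and
    [|n|^gamma], whose half-sum is [mode_cov n m] again. *)
Lemma iterated_carre_du_champ_trig (gamma : R) (I : finType) (k : I -> int)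
    (a : I -> R[i]) : 0 < gamma < 2 ->
  iterated_carre_du_champ gamma (trig_poly k a) =
  trig_poly (fun p : I * I => k p.1 - k p.2)
    (fun p => a p.1 * Num.conj (a p.2) * (mode_cov gamma (k p.1) (k p.2) ^+ 2)%:C).
Proof.
move=> g02; apply/funext => x; rewrite /iterated_carre_du_champ.
rewrite carre_du_champ_trig// !frac_laplacian_trig !carre_du_champ_trig//.
rewrite /trig_poly -!sumrB mulr_sumr; apply: eq_bigr => p _.
rewrite [Num.conj (_ * _)]rmorphM /=.
set A := a _; set B := Num.conj (a _); set E := fourier_mode _ _.
have -> : Num.conj (- mode_symbol gamma (k p.2))%:C = (- mode_symbol gamma (k p.2))%:C.
  by rewrite conj_complex oppr0.
rewrite /mode_cov; set u := mode_symbol _ _; set v := mode_symbol _ _.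
set w := mode_symbol _ _.
rewrite !(rmorphXn, rmorphM, rmorphD, rmorphN) /=.
rewrite (_ : (2^-1 : R)%:C = 2^-1); last by rewrite fmorphV rmorph_nat.
by field.
Qed.

End FourierCoefficients.

(** * Vanishing energy forces vanishing coefficients *)

Section Energy.
Local Open Scope classical_set_scope.
Local Open Scope complex_scope.
Local Open Scope ring_scope.
Context {R : realType}.
Local Notation mu := (@lebesgue_measure R).
Local Notation D0 := (~` [set 0 : R]).

Lemma Cintegral_ae_eq (D : set (measurableTypeR R)) (F G : R -> R[i]) :
  measurable D -> Cintegrable D F -> Cintegrable D G ->
  {ae mu, forall x, D x -> F x = G x} -> Cintegral D F = Cintegral D G.
Proof.
move=> mD [Fr Fi] [Gr Gi] FG; rewrite /Cintegral; congr Complex; congr fine.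
  apply: (ae_eq_integral _ _ mD (measurable_int mu Fr) (measurable_int mu Gr)).
  by apply: filterS FG => x FG Dx; rewrite /= FG.
apply: (ae_eq_integral _ _ mD (measurable_int mu Fi) (measurable_int mu Gi)).
by apply: filterS FG => x FG Dx; rewrite /= FG.
Qed.

(** Almost-everywhere equality suffices because Fourier coefficients do not see
    null sets; those of the constant [c] vanish at nonzero frequencies. *)
Lemma ae_cst_trig_poly0 (I : finType) (k : I -> int) (a : I -> R[i]) (c : R[i]) :
  injective k -> (forall i, k i != 0) ->
  {ae mu, forall x, trig_poly k a x = c} -> forall i, a i = 0.
Proof.
move=> kinj k0 fc i.
have cE : (fun=> c) = trig_poly (fun _ : unit => 0%Z) (fun=> c).
  apply/funext => x; rewrite /trig_poly (bigD1 tt)//= big1 ?addr0; last by case.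
  by rewrite fourier_mode0 mulr1.
have : fourier_coef (trig_poly k a) (k i) = fourier_coef (fun=> c) (k i).
  congr (_ * _); apply: Cintegral_ae_eq.
  - exact: measurable_itv.
  - exact: Cintegrable_fourier_coef_trig.
  - have := Cintegrable_fourier_coef_trig (fun _ : unit => 0%Z) (fun=> c) (k i).
    by rewrite -cE.
  - have ? : Filter (nbhs (almost_everywhere mu)) := ae_filter_ringOfSetsType _.
    by apply: filterS fc => x fx _; rewrite fx.
rewrite cE !fourier_coef_trig (bigD1 i)//= eqxx mulr1n big1 ?addr0; last first.
  by move=> j ji; rewrite (inj_eq kinj) (negbTE ji).
move=> ->; rewrite big1// => -[] _.
by rewrite eq_sym (negbTE (k0 i)).
Qed.

(** The energy density is [|f z - f 0|^2] times a density that is positive off 0,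
    so a vanishing integral makes the increments vanish almost everywhere. *)
Lemma carre_du_champ_self_at0 (gamma : R) (I : finType) (k : I -> int)
    (a : I -> R[i]) : 0 < gamma < 2 ->
  let f := trig_poly k a in
  0 <= complex.Re (carre_du_champ gamma f f 0) /\
  (complex.Re (carre_du_champ gamma f f 0) = 0 -> {ae mu, forall x, f x = f 0}).
Proof.
move=> g02 f.
set F := fun z =>
  (f (0 + z) - f 0) * (f (0 + z) - f 0)^* * (levy_density gamma z)%:C.
have [iF _] : Cintegrable D0 F by exact: Cintegrable_carre_du_champ_trig.
pose g z := complex.Re (F z).
have gE z : g z = (complex.Re (f z - f 0) ^+ 2 +
    complex.Im (f z - f 0) ^+ 2) * levy_density gamma z.
  rewrite /g /F add0r; case: (f z - f 0) => p q; rewrite conj_complex /=; ring.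
have g0 z : 0 <= g z.
  by rewrite gE mulr_ge0 ?levy_density_ge0// addr_ge0 ?sqr_ge0.
have -> : complex.Re (carre_du_champ gamma f f 0) = 2^-1 * \int[mu]_(z in D0) g z.
  rewrite /carre_du_champ -/F (_ : 2^-1 = (2^-1 : R)%:C); last first.
    by rewrite fmorphV rmorph_nat.
  by rewrite complex_ReM /= mul0r subr0.
split; first by rewrite mulr_ge0// Rintegral_ge0.
move/eqP; rewrite mulf_eq0 invr_eq0 pnatr_eq0 /= => /eqP I0.
have I1 : (\int[mu]_(z in D0) `|(g z)%:E| = 0)%E.
  under eq_integral do rewrite abse_EFin ger0_norm//.
  rewrite -(@fineK _ (integral _ _ _)); first by congr EFin.
  by apply: integrable_fin_num iF; exact: measurable_punctured.
have aeF : Filter (nbhs (almost_everywhere mu)) := ae_filter_ringOfSetsType _.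
have /(ae_eq_integral_abs mu (@measurable_punctured R) (measurable_int mu iF)) := I1.
apply: filterS => z /= gz; have [->//|z0] := eqVneq z 0.
have /eqP := gz (elimN eqP z0).
rewrite eqe -/(g z) gE mulf_eq0 [X in _ || X]gt_eqF ?orbF; last first.
  by rewrite mulr_gt0 ?powR_gt0 ?normr_gt0//; have [] := levy_const_spec g02.
rewrite paddr_eq0 ?sqr_ge0// !sqrf_eq0 => /andP[re0 im0].
by apply/eqP; rewrite -subr_eq0 eq_complex; apply/andP.
Qed.

End Energy.

(** * Reduction of the curvature inequality to real quadratic forms *)

Section QuadraticForms.
Local Open Scope classical_set_scope.
Local Open Scope complex_scope.
Local Open Scope ring_scope.
Context {R : realType} {N : nat}.

(** The Hermitian form of a real symmetric matrix at [u + i v]: the cross terms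
    between [u] and [v] cancel by symmetry. *)
Lemma trig_poly_bform (M : 'M[R]_N) (k : 'I_N -> int) (a : 'I_N -> R[i]) (x : R) :
  M^T = M ->
  let b i := a i * fourier_mode (k i) x in
  let u := \row_i complex.Re (b i) in let v := \row_i complex.Im (b i) in
  trig_poly (fun p : 'I_N * 'I_N => k p.1 - k p.2)
    (fun p => a p.1 * Num.conj (a p.2) * (M p.1 p.2)%:C) x =
  (bform M u u + bform M v v)%:C.
Proof.
move=> Ms b u v.
transitivity (\sum_i \sum_j b i * Num.conj (b j) * (M i j)%:C).
  rewrite pair_big /=; apply: eq_bigr => p _.
  by rewrite fourier_modeB /b rmorphM /=; ring.
transitivity ((bform M u u + bform M v v) +i* (bform M v u - bform M u v)).
  rewrite !bformE -!sumrB -!big_split /=.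
  have cs (f g : 'I_N -> R) : (\sum_i f i) +i* (\sum_i g i) = \sum_i (f i +i* g i).
    elim/big_ind3: _ => // x1 x2 x3 y1 y2 y3 <- <- //.
  rewrite cs; apply: eq_bigr => i _; rewrite -sumrB -big_split /= cs.
  apply: eq_bigr => j _; rewrite !mxE; case: (b i) (b j) => [p q] [r s].
  rewrite conj_complex; apply/eqP; rewrite eq_complex /=.
  by apply/andP; split; apply/eqP; ring.
by rewrite (bform_sym v u Ms) subrr.
Qed.

End QuadraticForms.

Section Curvature.
Local Open Scope classical_set_scope.
Local Open Scope complex_scope.
Local Open Scope ring_scope.
Context {R : realType} (gamma : R) (N : nat).
Hypothesis g02 : 0 < gamma < 2.
Local Notation B := (fbm_mx (gamma / 2) N : 'M[R]_N).
Local Notation A := (hadamard_sq B).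

Definition pos_freq (i : 'I_N) : int := i.+1%:Z.

Lemma fbm_mxE i j : B i j = mode_cov gamma (pos_freq i) (pos_freq j).
Proof.
rewrite mxE /mode_cov mulrC (mulrC 2) divfK ?pnatr_eq0//.
by rewrite [in RHS]mulrC [mode_symbol _ (_ - _)]mode_symbolE intrB.
Qed.

Lemma fbm_mx_sym : B^T = B.
Proof.
by apply/matrixP => i j; rewrite !mxE distrC [X in X - _]addrC.
Qed.

Lemma hadamard_sq_sym : A^T = A.
Proof. by rewrite /hadamard_sq matrix.map_trmx fbm_mx_sym. Qed.

Section PosTrigPoly.
Variables (a : 'I_N -> R[i]) (x : R).
Let f := trig_poly pos_freq a.
Let u := \row_i complex.Re (a i * fourier_mode (pos_freq i) x).
Let v := \row_i complex.Im (a i * fourier_mode (pos_freq i) x).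

Lemma carre_du_champ_bform :
  carre_du_champ gamma f f x = (bform B u u + bform B v v)%:C.
Proof.
rewrite -trig_poly_bform ?fbm_mx_sym// carre_du_champ_trig//.
by apply: eq_bigr => p _; rewrite fbm_mxE.
Qed.

Lemma iterated_carre_du_champ_bform :
  iterated_carre_du_champ gamma f x = (bform A u u + bform A v v)%:C.
Proof.
rewrite -trig_poly_bform ?hadamard_sq_sym// iterated_carre_du_champ_trig//.
by apply: eq_bigr => p _; rewrite [A _ _]mxE fbm_mxE.
Qed.

End PosTrigPoly.

Lemma real_coef_parts (u : 'rV[R]_N) :
  (\row_i complex.Re ((u 0 i)%:C * fourier_mode (pos_freq i) (0 : R)) = u) *
  (\row_i complex.Im ((u 0 i)%:C * fourier_mode (pos_freq i) (0 : R)) = 0).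
Proof.
by split; apply/rowP => i; rewrite !mxE fourier_mode_at0 mulr1.
Qed.

(** The form at [u] is the energy at 0 of the polynomial with coefficients [u];
    its frequencies are distinct and nonzero. *)
Lemma fbm_mx_posdef (u : 'rV[R]_N) : u != 0 -> 0 < bform B u u.
Proof.
move=> u0; have := carre_du_champ_self_at0 pos_freq (fun i => (u 0 i)%:C) g02.
case; rewrite carre_du_champ_bform !real_coef_parts bform0 addr0 /= => B0 Bu.
rewrite lt0r B0 andbT; apply: contra_neq u0 => /Bu /ae_cst_trig_poly0 ua.
apply/rowP => i; rewrite mxE; apply: complexI; apply: ua => //.
by move=> i' j' /eqP; rewrite eqz_nat eqSS => /eqP/val_inj.
Qed.

(** Real coefficient vectors at [x = 0] already give the whole quadratic-form
    inequality; conversely it implies the inequality for the real and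
    imaginary parts at every point. *)
Lemma curvature_bound_bform :
  curvature_bound gamma N =
  [set l | forall u, l * bform B u u <= bform A u u].
Proof.
apply/seteqP; split => l /= lP.
  move=> u; have := lP (trig_poly pos_freq (fun i => (u 0 i)%:C)) _ 0.
  rewrite carre_du_champ_bform iterated_carre_du_champ_bform !real_coef_parts.
  by rewrite !bform0 !addr0 -rmorphM lecR; apply; exists (fun i => (u 0 i)%:C).
move=> f [a ->] x; rewrite -/(trig_poly pos_freq a).
rewrite carre_du_champ_bform iterated_carre_du_champ_bform -rmorphM lecR.
by rewrite mulrDr lerD.
Qed.

End Curvature.

Theorem theoremB (R : realType) (gamma H : R) (N : nat)
    (gamma_gt0 : 0 < gamma) (gamma_lt2 : gamma < 2)
    (HE : H = gamma / 2) (N_ge1 : (1 <= N)%N) :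
  exists kappa : R,
    is_bakry_emery_curvature gamma N kappa /\
    is_min_gen_eigenvalue (hadamard_sq (fbm_mx H N)) (fbm_mx H N) kappa.
Proof.
have g02 : 0 < gamma < 2 by rewrite gamma_gt0.
rewrite HE /is_bakry_emery_curvature (curvature_bound_bform _ g02).
apply: pencil_min_eigenvalue => //.
- exact: hadamard_sq_sym.
- exact: fbm_mx_sym.
- exact: fbm_mx_posdef.
Qed.
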